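(* Let $\mathcal{D}$ be a probability distribution over pairs $(x,y)$ of problems $x$ and true answers $y$, and let $\rho_x \in [0,1]$ (a random variable under $(x,y)\sim\mathcal{D}$) be the probability that one sampled guess of the model on problem $x$ is correct. For a number of samples $k$ let $\mathrm{Pass@}k(x) = 1-(1-\rho_x)^k$. Then $$\mathbb{E}_{(x,y)\sim\mathcal{D}}\left[\mathrm{Pass@}k(x)\right] \;\le\; 1 - \Big(\big(\mathbb{E}_{(x,y)\sim\mathcal{D}}[1-\rho_x]\big)^2 + \mathrm{Var}(\rho_x)\Big)^{k/2},$$ where $\mathrm{Var}(\rho_x)$ is the variance of $\rho_x$ under $(x,y)\sim\mathcal{D}$.
   Context: For a fixed model and decoding strategy, $\rho_x = P(\hat y = y \mid x)$ is the probability that a single sampled guess $\hat y$ on problem $x$ equals the true answer $y$ (also called Pass@1). The number of samples $k$ is a positive integer. $\mathrm{Pass@}k(x)$ is the probability that at least one of $k$ independently sampled guesses is correct, which equals $1-(1-\rho_x)^k$.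
   Formalization: The number of samples k is assumed to be at least 2: for k = 1 the inequality is false unless ρ_x is almost surely constant (if ρ_x is 0 or 1 with probability 1/2 each, the left side is 1/2 and the right side is about 0.293). *)

(* Defs.v *)
From HB Require Import structures.
From mathcomp Require Import all_boot all_order all_algebra.
From mathcomp Require Import all_classical all_reals all_analysis.
Set Implicit Arguments.
Unset Strict Implicit.
Unset Printing Implicit Defensive.
Import Order.TTheory GRing.Theory Num.Theory.
Local Open Scope classical_set_scope.
Local Open Scope ring_scope.

(* [model x] is the law of one guess sampled, for a fixed model and decoding
   strategy, on the problem [x]; [pass1 model (x, y)] is rho_x, the probability
   that such a guess equals [y].  The true answer is part of the data drawn from
   the distribution, so rho is a function of the pair. *)
Definition pass1 (R : realType) (dX dY : measure_display)
    (X : measurableType dX) (Y : measurableType dY)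
    (model : X -> probability Y R) (p : X * Y) : R :=
  fine (model p.1 [set p.2]).

Definition pass_at (R : realType) (dX dY : measure_display)
    (X : measurableType dX) (Y : measurableType dY)
    (model : X -> probability Y R) (k : nat) (p : X * Y) : R :=
  1 - (1 - pass1 model p) ^+ k.

(* Main.v *)
Require Import Defs.
From HB Require Import structures.
From mathcomp Require Import all_boot all_order all_algebra.
From mathcomp Require Import all_classical all_reals all_analysis.
From mathcomp Require Import measurable_realfun ring lra.
Set Implicit Arguments.
Unset Strict Implicit.
Unset Printing Implicit Defensive.
Import Order.TTheory GRing.Theory Num.Theory.
Local Open Scope classical_set_scope.
Local Open Scope ring_scope.

(* Put q = 1 - rho.  The base of the power is E[q]^2 + Var(q) = E[q^2], so the
   claim is Lyapunov's inequality E[q^2]^(k/2) <= E[q^k]; it follows by taking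
   expectations in the tangent-line bound for t^(k/2) at t = E[q^2], which for
   integer k and c = sqrt E[q^2] is a polynomial inequality in q and c. *)

(** With [k = n + 2], this is twice the tangent bound for [t^(k/2)] at [t = c^2], taken at
    [t = q^2]. Induction on [n] avoids fractional powers and any division by [c]. *)
Lemma tangent_exprn (R : realDomainType) (n : nat) (q c : R) :
  0 <= q -> 0 <= c ->
  n.+2%:R * c ^+ n * q ^+ 2 <= 2 * q ^+ n.+2 + n%:R * c ^+ n.+2.
Proof.
move=> q0 c0; elim: n => [|n IH]; first by rewrite expr0; lra.
rewrite -subr_ge0.
(* The new gap is [q] times the previous gap plus a remainder with a double root at the tangency
   point [q = c]. *)
have -> : 2 * q ^+ n.+3 + n.+1%:R * c ^+ n.+3 - n.+3%:R * c ^+ n.+1 * q ^+ 2 =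
    q * (2 * q ^+ n.+2 + n%:R * c ^+ n.+2 - n.+2%:R * c ^+ n * q ^+ 2) +
    c ^+ n * ((q - c) ^+ 2 * (n.+2%:R * q + n.+1%:R * c)).
  by rewrite -[n.+3]addn3 -[n.+2]addn2 -[n.+1]addn1 !natrD !exprD; ring.
apply: addr_ge0; first by rewrite mulr_ge0// subr_ge0.
rewrite mulr_ge0 ?exprn_ge0// mulr_ge0 ?sqr_ge0//.
by apply: addr_ge0; exact: mulr_ge0.
Qed.

Section expectation_unit_interval.
Context d (T : measurableType d) (R : realType) (P : probability T R).
Context (q : T -> R) (mq : measurable_fun [set: T] q)
  (q01 : forall x, 0 <= q x <= 1).

(** Powers of [q] stay in [[0, 1]], and bounded measurable functions are integrable under a
    probability. *)
Lemma Lfun1_exprn (n : nat) : (fun x => q x ^+ n) \in Lfun P 1.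
Proof.
apply/Lfun1_integrable; apply: measurable_bounded_integrable => //.
- by rewrite (le_lt_trans (probability_le1 P _))// ltry.
- exact: measurable_funX.
- exists 1; split => // M M1 x _ /=; have /andP[q0 q1] := q01 x.
  by rewrite ger0_norm ?exprn_ge0// (le_trans (exprn_ile1 n q0 q1))// ltW.
Qed.

Lemma expectation_exprn_fin_num (n : nat) :
  'E_P[(fun x => q x ^+ n)%R]%E \is a fin_num.
Proof. exact: expectation_fin_num (Lfun1_exprn n). Qed.

Lemma lyapunov_expectation (k : nat) : (2 <= k)%N ->
  ('E_P[(fun x => q x ^+ 2)%R] `^ (k%:R / 2) <= 'E_P[(fun x => q x ^+ k)%R])%E.
Proof.
case: k => [|[|n]]// _.
have q0 x : 0 <= q x by case/andP: (q01 x).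
have m0 : (0 <= 'E_P[(fun x => q x ^+ 2)%R])%E.
  by apply: expectation_ge0 => x; exact: exprn_ge0.
have mX i : measurable_fun [set: T] (fun x => q x ^+ i) by exact: measurable_funX.
have L2 := Lfun1_exprn 2; have Lk := Lfun1_exprn n.+2.
move: (expectation_exprn_fin_num n.+2) (expectation_exprn_fin_num 2).
case Ek : 'E_P[(fun x => q x ^+ n.+2)%R]%E => [M| |]// _.
move: m0; case E2 : 'E_P[(fun x => q x ^+ 2)%R]%E => [m| |]// + _.
rewrite lee_fin => m0.
(* The square root turns the real power [m^(k/2)] into the integer power [c^k]; [c = 0] is
   allowed. *)
pose c := Num.sqrt m; have c0 : 0 <= c by exact: sqrtr_ge0.
have c2 : c ^+ 2 = m by exact: sqr_sqrtr.
have -> : (m%:E `^ (n.+2%:R / 2) = (c ^+ n.+2)%:E)%E.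
  by rewrite poweR_EFin mulrC powRrM powR12_sqrt// powR_mulrn.
pose F := (n.+2%:R * c ^+ n) \o* (fun x => q x ^+ 2).
pose G := (2 \o* (fun x => q x ^+ n.+2)) \+ cst (n%:R * c ^+ n.+2).
have FG : ('E_P[F] <= 'E_P[G])%E.
  apply: expectation_le.
  - exact: measurable_funM.
  - by apply: measurable_funD => //; exact: measurable_funM.
  - by move=> x; apply: mulr_ge0; [exact: exprn_ge0 | rewrite mulr_ge0 ?exprn_ge0].
  - move=> x; apply: addr_ge0; last by rewrite mulr_ge0 ?exprn_ge0.
    by apply: mulr_ge0; first exact: exprn_ge0.
  - apply: aeW => x; rewrite /F /G /=.
    by have := tangent_exprn n (q0 x) c0; rewrite [leLHS]mulrC [2 * _]mulrC.
move: FG; rewrite /F /G expectationZl// expectationD ?Lfun_cst//; last first.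
  by apply: Lfun_scale.
rewrite expectationZl// expectation_cst Ek E2 -!EFinM -EFinD !lee_fin -c2.
(* Since [E[q^2] = c^2], the left side takes its value at the tangency point; the terms in [n] then
   cancel, leaving [2 c^k <= 2 E[q^k]]. *)
have -> : n.+2%:R * c ^+ n * c ^+ 2 = 2 * c ^+ n.+2 + n%:R * c ^+ n.+2.
  by rewrite -[n.+2]addn2 natrD exprD; ring.
by rewrite lerD2r ler_pM2l.
Qed.

Lemma sqr_expectationDvariance :
  ('E_P[q] ^+ 2 + 'V_P[q] = 'E_P[(fun x => q x ^+ 2)%R])%E.
Proof.
(* The powers 1 and 2 are convertible to [q] and [q * q]. *)
have L1 : q \in Lfun P 1 := Lfun1_exprn 1.
have L2 : q * q \in Lfun P 1 := Lfun1_exprn 2.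
rewrite /variance covarianceE// -[('E_P[q] ^+ 2)%E]/('E_P[q] * 'E_P[q])%E.
rewrite addeC subeK//.
by rewrite fin_numM// expectation_fin_num.
Qed.

End expectation_unit_interval.

(** Centering [1 - f] at its mean [1 - E[f]] gives the negative of the centered [f], with the same
    square. *)
Lemma variance_onem d (T : measurableType d) (R : realType)
    (P : probability T R) (f : T -> R) :
  f \in Lfun P 1 -> 'V_P[(fun x => 1 - f x)%R]%E = 'V_P[f]%E.
Proof.
move=> Lf.
have E1 : ('E_P[(fun x => 1 - f x)%R] = 1 - 'E_P[f])%E.
  by rewrite -[RHS]/(1%:E - _)%E -(expectation_cst P 1) -expectationB ?Lfun_cst.
rewrite /variance unlock E1; congr expectation; apply/funext => x /=.
rewrite fineB ?expectation_fin_num//=; set e := fine _.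
change ((1 - f x - (1 - e)) * (1 - f x - (1 - e)) = (f x - e) * (f x - e)).
by ring.
Qed.

Lemma pass1_itv (R : realType) (dX dY : measure_display)
    (X : measurableType dX) (Y : measurableType dY)
    (model : X -> probability Y R) (hY : forall y : Y, measurable [set y]) p :
  0 <= pass1 model p <= 1.
Proof.
rewrite fine_ge0//= -lee_fin fineK ?fin_num_measure//.
exact: probability_le1.
Qed.

Theorem proposition6p1 (R : realType) (dX dY : measure_display)
    (X : measurableType dX) (Y : measurableType dY)
    (D : probability (X * Y)%type R)
    (model : X -> probability Y R)
    (* the event that a guess equals the true answer is measurable *)
    (hY : forall y : Y, measurable [set y])
    (* rho is a random variable under D *)
    (hrho : measurable_fun [set: X * Y] (pass1 model))
    (k : nat)
    (* the inequality fails for k = 1 unless rho is almost surely constant *)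
    (hk : (2 <= k)%N) :
  ('E_D[pass_at model k] <=
     1 - (('E_D[(fun p => 1 - pass1 model p)%R]) ^+ 2 + 'V_D[pass1 model])
           `^ (k%:R / 2))%E.
Proof.
pose q p := 1 - pass1 model p.
have mq : measurable_fun [set: X * Y] q by exact: measurable_funB.
have q01 p : 0 <= q p <= 1.
  by have := pass1_itv model hY p; rewrite /q; lra.
have -> : ('V_D[pass1 model] = 'V_D[q])%E.
  rewrite variance_onem//.
  exact: (Lfun1_exprn D hrho (pass1_itv model hY) 1).
rewrite -/q (sqr_expectationDvariance D mq q01).
(* By linearity the left side is [1 - E[q^k]], so an upper bound on it amounts to a lower bound on
   [E[q^k]]. *)
rewrite [pass_at model k](_ : _ = cst 1 \- (fun p => q p ^+ k))//.
rewrite expectationB ?Lfun_cst//; last exact: Lfun1_exprn.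
rewrite expectation_cst leeB//.
exact: lyapunov_expectation.
Qed.
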